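(* Let $\Omega\subset\mathbb{R}^N$ ($N\ge 2$) be a smooth bounded domain, let $0<a<1$, and let $q\in C^{0,\alpha}(\overline\Omega)$ for some $\alpha\in(0,1)$, with $q>0$ in $\overline\Omega$. Let $\beta\in\mathbb{R}$ and let $p\in C^1(\Omega)$ be negative in $\Omega$ and such that there exist constants $c_1,c_2>0$ with $$c_1\,d(x)^\beta\le |p(x)|\le c_2\,d(x)^\beta\qquad\text{for all }x\in\Omega .$$ Let $g\in C^1(0,\infty)$ be a positive decreasing function such that $\lim_{s\searrow 0}g(s)=+\infty$, and assume that there exists $\gamma>\max\{1,\beta+1\}$ such that $\lim_{s\searrow 0}s^\gamma g(s)\in(0,\infty)$. Then the problem $$-\Delta u=p(x)g(u)+q(x)|\nabla u|^a\ \text{ in }\Omega,\qquad u>0\ \text{ in }\Omega,\qquad u=0\ \text{ on }\partial\Omega$$ has no classical solutions.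
   Context: For $x\in\Omega$, $d(x):=\operatorname{dist}(x,\partial\Omega)$. A classical solution is a function $u\in C^2(\Omega)\cap C(\overline\Omega)$ satisfying the equation, the positivity condition and the boundary condition pointwise. *)

(* Defs.v *)
From HB Require Import structures.
From mathcomp Require Import all_boot all_order all_algebra.
From mathcomp Require Import all_classical all_reals all_analysis.

Set Implicit Arguments.
Unset Strict Implicit.
Unset Printing Implicit Defensive.

Import Order.TTheory GRing.Theory Num.Theory.
Import numFieldNormedType.Exports.

Local Open Scope classical_set_scope.
Local Open Scope ring_scope.

(* The library norm on ['rV[R]_n] is the sup norm.  Its topology and bounded
   sets are the usual ones, but |grad u| and dist(x, bd Omega) refer to the
   Euclidean norm. *)
Definition enorm (R : realType) (n : nat) (x : 'rV[R]_n) : R :=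
  Num.sqrt (\sum_(i < n) x 0 i ^+ 2).

Definition eball (R : realType) (n : nat) (x : 'rV[R]_n) (r : R) :
    set 'rV[R]_n :=
  [set y | enorm (y - x) < r].

Definition boundary (T : topologicalType) (A : set T) : set T :=
  closure A `\` interior A.

Definition bdist (R : realType) (n : nat) (Omega : set 'rV[R]_n)
    (x : 'rV[R]_n) : R :=
  inf [set enorm (x - y) | y in boundary Omega].

Definition partial (R : realType) (n : nat) (i : 'I_n) (f : 'rV[R]_n -> R) :
    'rV[R]_n -> R :=
  fun x => 'D_(delta_mx 0 i) f x.

Definition grad (R : realType) (n : nat) (f : 'rV[R]_n -> R)
    (x : 'rV[R]_n) : 'rV[R]_n :=
  \row_(i < n) partial i f x.

Definition laplacian (R : realType) (n : nat) (f : 'rV[R]_n -> R)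
    (x : 'rV[R]_n) : R :=
  \sum_(i < n) partial i (partial i f) x.

(* [U] is meant to be open, so that the values of [f] outside [U] are
   irrelevant. *)
Fixpoint Ck (R : realType) (n : nat) (k : nat) (U : set 'rV[R]_n)
    (f : 'rV[R]_n -> R) : Prop :=
  (forall x, U x -> {for x, continuous f}) /\
  match k with
  | 0%N => True
  | k'.+1 => forall i : 'I_n,
      (forall x, U x -> derivable f x (delta_mx 0 i)) /\ Ck k' U (partial i f)
  end.

Definition Cinfty (R : realType) (n : nat) (U : set 'rV[R]_n)
    (f : 'rV[R]_n -> R) : Prop :=
  forall k, Ck k U f.

Definition C1_pos (R : realType) (g : R -> R) : Prop :=
  forall s, 0 < s -> derivable g s 1 /\ {for s, continuous (derive1 g)}.

Definition holder (R : realType) (n : nat) (alpha : R) (A : set 'rV[R]_n)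
    (f : 'rV[R]_n -> R) : Prop :=
  exists C : R, forall x y, A x -> A y ->
    `|f x - f y| <= C * enorm (x - y) `^ alpha.

(* Near each boundary point, up to relabelling and reorienting the coordinate
   axes (the choice of [i] and of the sign [b]), Omega is the region above the
   graph of a smooth function of the remaining N - 1 coordinates [col' i x]. *)
Definition smooth_boundary (R : realType) (N : nat) (Omega : set 'rV[R]_N) :
    Prop :=
  forall x0, boundary Omega x0 ->
    exists (r : R) (i : 'I_N) (b : bool) (h : 'rV[R]_N.-1 -> R),
      [/\ 0 < r, Cinfty setT h &
          Omega `&` eball x0 r =
          [set x : 'rV[R]_N | 0 < (-1) ^+ b * (x 0 i - h (col' i x))] `&`
          eball x0 r].

Definition smooth_bounded_domain (R : realType) (N : nat)
    (Omega : set 'rV[R]_N) : Prop :=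
  [/\ open Omega, connected Omega, Omega !=set0, bounded_set Omega &
      smooth_boundary Omega].

Definition classical_solution (R : realType) (N : nat) (Omega : set 'rV[R]_N)
    (p q : 'rV[R]_N -> R) (g : R -> R) (a : R) (u : 'rV[R]_N -> R) : Prop :=
  [/\ Ck 2 Omega u,
      {within closure Omega, continuous u},
      forall x, Omega x ->
        - laplacian u x = p x * g (u x) + q x * enorm (grad u x) `^ a,
      forall x, Omega x -> 0 < u x &
      forall x, boundary Omega x -> u x = 0].

(* Main.v *)
Require Import Defs.
From HB Require Import structures.
From mathcomp Require Import all_boot all_order all_algebra.
From mathcomp Require Import ring lra.
From mathcomp Require Import all_classical all_reals all_analysis.

Set Implicit Arguments.
Unset Strict Implicit.
Unset Printing Implicit Defensive.

Import Order.TTheory GRing.Theory Num.Theory.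
Import numFieldNormedType.Exports.

Local Open Scope classical_set_scope.
Local Open Scope ring_scope.

(** Near a boundary point [x0] the domain is [{phi > 0}], where [phi] is the
    signed height above the boundary graph. The partial derivatives of [phi] up
    to order two are bounded, its gradient has length at least 1, and [phi] is
    comparable to the distance to the boundary. If [M] bounds [q] near [x0], a
    solution [u] satisfies there

      [Delta u + M |grad u|^a >= |p| g(u) >= 0],

    and it vanishes on the boundary. This inequality allows comparison with
    barriers [w = A |x - y|^2 + F(phi)]: at an interior maximum of [u - w] the
    gradients agree and [Delta u <= Delta w], so [u <= w] in a small ball around
    [y] as soon as [w] violates the inequality and [u <= w] on the edge of the
    ball and on the boundary of the domain ([comparison], [chart_touching_le]).

    The barrier with [F(t) = A (t - k t^2)], centred at the boundary point below
    a given [x], gives [u <= C phi] near [x0] ([linear_bound]). As [g] decreases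
    and behaves like [s^(- gamma)] at 0, the source satisfies
    [|p| g(u) >= c phi^(beta - gamma) >= c phi^(sigma - 2)] for some [sigma] in
    [(0, 1)], because [beta - gamma < -1].

    A source of order [phi^(sigma - 2)] is not integrable across the boundary,
    so it drives the normal derivative of [u] to minus infinity. Quantitatively,
    [F(t) = C t - K t^sigma] is an admissible barrier at [x0] when [K] is small:
    all the terms of its inequality are at most of order [phi^(sigma - 2)].
    Since [sigma < 1], that barrier is negative on the vertical line just above
    [x0], which contradicts [u > 0] ([no_positive_solution]). *)

(** * Second derivative test *)

(** Directional derivatives are derivatives along a line; this turns the
    one-variable calculus below into statements about [partial]. *)
Lemma is_derive_lineE (R : realType) (V : normedModType R) (f : V -> R)
    (x v : V) (t d : R) :
  is_derive t 1 (fun s => f (x + s *: v)) d <-> is_derive (x + t *: v) v f d.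
Proof.
have E : (fun h => h^-1 *: (((fun s => f (x + s *: v)) \o shift t) (h *: 1)
                            - f (x + t *: v))) =
         (fun h => h^-1 *: ((f \o shift (x + t *: v)) (h *: v)
                            - f (x + t *: v))).
  apply/funext => h /=; congr (_ *: (f _ - _)).
  by rewrite [h *: 1]mulr1 scalerDl addrCA.
split=> -[D <-]; (split; last by rewrite /derive E).
- by move: D; rewrite /derivable E.
- by rewrite /derivable E.
Qed.

Lemma near_line (R : realType) (V : normedModType R) (P : set V) (x v : V) :
  (\forall y \near x, P y) -> \forall t \near (0 : R), P (x + t *: v).
Proof.
move=> Px.
have : x + t *: v @[t --> (0 : R)] --> x.
  rewrite -[X in _ --> X]addr0 -[X in _ --> _ + X](scale0r v).
  by apply: cvgD; [exact: cvg_cst|apply: cvgZr_tmp; exact: cvg_id].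
exact.
Qed.

(** If [f2] were positive, [f1] would be positive just to the right of its zero
    0, and the mean value theorem would make [f] increase there. *)
Lemma second_derivative_test (R : realType) (f f1 : R -> R) (f2 : R) :
  (\forall t \near (0 : R), is_derive (t : R) 1 f (f1 t)) -> is_derive (0 : R) 1 f1 f2 ->
  (\forall t \near (0 : R), f t <= f 0) -> f1 0 = 0 /\ f2 <= 0.
Proof.
move=> df [df1 f2E] fmax.
have f10 : f1 0 = 0.
  have [e /= e0 H] : \forall t \near (0 : R), is_derive (t : R) 1 f (f1 t) /\ f t <= f 0.
    by near=> t; split; near: t.
  have He t : t \in `]-e, e[%R -> is_derive (t : R) 1 f (f1 t) /\ f t <= f 0.
    by rewrite in_itv/= => te; apply: H; rewrite /ball_/= sub0r normrN ltr_norml.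
  have zin : 0 \in `]-e, e[%R by rewrite in_itv/= oppr_lt0 e0.
  have [_ <-] := (He _ zin).1.
  have ee : - e <= e by lra.
  have [_ ->//] := derive1_at_max ee
    (fun t te => @ex_derive _ _ _ _ _ _ _ (He t te).1) zin (fun t te => (He t te).2).
split=> //; rewrite leNgt; apply/negP => f20.
have : h^-1 *: ((f1 \o shift 0) (h *: 1) - f1 0) @[h --> 0^'] --> f2.
  by rewrite -f2E.
move=> /cvgr_gt /(_ _ f20); rewrite /= -/(nbhs _ _) => near_pos.
have [e /= e0 H] : \forall t \near (0:R), [/\ is_derive (t : R) 1 f (f1 t), f t <= f 0
   & t != 0 -> 0 < t^-1 *: ((f1 \o shift 0) (t *: 1) - f1 0)].
  by near=> t; split; near: t.
have He t : `|t| < e -> [/\ is_derive (t : R) 1 f (f1 t), f t <= f 0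
   & 0 < t -> 0 < f1 t].
  move=> te; have [|A B C] := H t; first by rewrite /ball_/= sub0r normrN.
  split=> // t0; move: (C (lt0r_neq0 t0)).
  by rewrite /= f10 subr0 addr0 [t *: 1]mulr1 pmulr_rgt0// invr_gt0.
have e2 : 0 < e / 2 by rewrite divr_gt0.
have [||c] := @MVT _ f f1 0 (e/2) e2.
- move=> x; rewrite in_itv/= => /andP[x0 xe].
  by have [] := He x ltac:(by rewrite ger0_norm ?ltW//; lra).
- apply: derivable_within_continuous => x; rewrite in_itv/= => /andP[x0 xe].
  by have [[]] := He x ltac:(by rewrite ger0_norm//; lra).
rewrite in_itv/= subr0 => /andP[c0 ce] /eqP; rewrite subr_eq => /eqP Ef.
have [_ + _] := He (e/2) ltac:(by rewrite ger0_norm ?ltW//; lra).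
have [_ _ /(_ c0) f1c] := He c ltac:(by rewrite ger0_norm ?ltW//; lra).
by rewrite Ef leNgt ltrDr mulr_gt0.
Unshelve. all: by end_near. Qed.

Lemma directional_derivative_test (R : realType) (V : normedModType R)
    (f f1 : V -> R) (f2 : R) (x v : V) :
  (\forall y \near x, is_derive y v f (f1 y)) -> is_derive x v f1 f2 ->
  (\forall y \near x, f y <= f x) -> f1 x = 0 /\ f2 <= 0.
Proof.
move=> df df1 fmax.
have := @second_derivative_test _ (fun t => f (x + t *: v))
  (fun t => f1 (x + t *: v)) f2.
rewrite scale0r addr0; apply.
- by apply: filterS (near_line v df) => t /is_derive_lineE.
- by apply/is_derive_lineE; rewrite scale0r addr0.
- exact: (near_line v fmax).
Qed.

(** * Squared Euclidean distance *)

(** Working with the square of the Euclidean distance avoids square roots: it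
    is a polynomial in the coordinates, hence a smooth term of the barriers. *)
Definition sqdist (R : realType) (n : nat) (x y : 'rV[R]_n) : R :=
  \sum_(i < n) (x 0 i - y 0 i) ^+ 2.

Lemma sqdist_ge0 (R : realType) n (x y : 'rV[R]_n) : 0 <= sqdist x y.
Proof. by apply: sumr_ge0 => i _; exact: sqr_ge0. Qed.

Lemma sqdistxx (R : realType) n (x : 'rV[R]_n) : sqdist x x = 0.
Proof. by apply: big1 => i _; rewrite subrr expr0n. Qed.

Lemma sqdistC (R : realType) n (x y : 'rV[R]_n) : sqdist x y = sqdist y x.
Proof. by apply: eq_bigr => i _; rewrite -sqrrN opprB. Qed.

Lemma enorm_sqdist (R : realType) n (x y : 'rV[R]_n) :
  enorm (x - y) = Num.sqrt (sqdist x y).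
Proof. by congr Num.sqrt; apply: eq_bigr => i _; rewrite !mxE. Qed.

Lemma eball_sqdist (R : realType) n (x y : 'rV[R]_n) (r : R) : 0 < r ->
  eball x r y <-> sqdist y x < r ^+ 2.
Proof.
move=> r0; rewrite /eball/= enorm_sqdist.
by rewrite -{1}(gtr0_norm r0) -sqrtr_sqr ltr_sqrt ?exprn_gt0.
Qed.

Lemma sqdist_addl (R : realType) n (x : 'rV[R]_n) i (t : R) :
  sqdist (x + t *: delta_mx 0 i) x = t ^+ 2.
Proof.
rewrite /sqdist (bigD1 i)//= big1 => [|j /negPf ij]; last first.
  by rewrite !mxE eqxx ij mulr0 addr0 subrr expr0n.
by rewrite !mxE !eqxx mulr1 addr0 addrAC subrr add0r.
Qed.

(** A substitute for the triangle inequality, from [(s + t)^2 <= 2 s^2 + 2 t^2];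
    the factor 2 is absorbed by shrinking radii. *)
Lemma sqdist_triangle (R : realType) n (x y z : 'rV[R]_n) :
  sqdist x z <= 2 * sqdist x y + 2 * sqdist y z.
Proof.
rewrite /sqdist !mulr_sumr -big_split/=; apply: ler_sum => i _.
by have := sqr_ge0 (x 0 i - y 0 i - (y 0 i - z 0 i)); nra.
Qed.

Lemma ler_coord_sqdist (R : realType) n (x y : 'rV[R]_n) i :
  (x 0 i - y 0 i) ^+ 2 <= sqdist x y.
Proof.
by rewrite /sqdist (bigD1 i)//= lerDl sumr_ge0// => j _; exact: sqr_ge0.
Qed.

Lemma ler_coord_enorm (R : realType) n (x y : 'rV[R]_n) i :
  `|x 0 i - y 0 i| <= enorm (x - y).
Proof. by rewrite enorm_sqdist -sqrtr_sqr ler_wsqrtr// ler_coord_sqdist. Qed.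

Lemma enorm_le_sum (R : realType) n (v : 'rV[R]_n) :
  enorm v <= \sum_(i < n) `|v 0 i|.
Proof.
have s0 : 0 <= \sum_(i < n) `|v 0 i| by apply: sumr_ge0.
rewrite -(ger0_norm s0) -sqrtr_sqr ler_wsqrtr//.
suff [] : \sum_(i < n) v 0 i ^+ 2 <= (\sum_(i < n) `|v 0 i|) ^+ 2 /\
  0 <= \sum_(i < n) `|v 0 i| by [].
elim/big_rec2 : _ => [|i a b _ [ab b0]]; first by rewrite expr0n.
split; last by rewrite addr_ge0.
by rewrite -(real_normK (num_real (v 0 i))); have := normr_ge0 (v 0 i); nra.
Qed.

Lemma continuous_sqdist (R : realType) n (y : 'rV[R]_n) :
  continuous (fun x => sqdist x y).
Proof.
apply: (@continuous_big _ _ +%R 0 xpredT) => [|i _]; first exact: add_continuous.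
have cx (x : 'rV[R]_n) : {for x, continuous (fun z : 'rV[R]_n => z 0 i - y 0 i)}.
  by apply: continuousB; [exact: coord_continuous|exact: cst_continuous].
by move=> x; exact: (continuousM (cx x) (cx x)).
Qed.

(** The topology is that of the sup norm, which is dominated by the Euclidean
    norm. *)
Lemma near_sqdist (R : realType) n (x : 'rV[R]_n) (P : set 'rV[R]_n) :
  (\forall y \near x, P y) ->
  exists2 r : R, 0 < r & forall y, sqdist y x < r ^+ 2 -> P y.
Proof.
move=> /nbhs_ballP[e /= e0 H]; exists e => // y yx; apply: H; split=> // i j.
rewrite ord1; rewrite /ball/=.
rewrite -ltr_sqr ?nnegrE ?(ltW e0)// real_normK ?num_real//.
by apply: le_lt_trans yx; rewrite sqdistC ler_coord_sqdist.
Qed.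

Lemma sqdist_near (R : realType) n (x y : 'rV[R]_n) (r : R) :
  sqdist x y < r -> \forall z \near x, sqdist z y < r.
Proof. by move=> xy; apply: (cvgr_lt _ (@continuous_sqdist _ _ y x)). Qed.

(** * Comparison by touching *)

Lemma compact_closure_bounded (R : realType) n (A : set 'rV[R]_n) :
  bounded_set A -> compact (closure A).
Proof.
move=> [M [_ HM]]; apply: bounded_closed_compact; last exact: closed_closure.
exists (M + 1); split; first exact: num_real.
move=> x Mx z zA; apply: (le_trans _ (ltW Mx)).
have AM : A `<=` [set y | `|y| <= M + 1] by apply: HM; rewrite ltrDl.
have clM : closed [set y : 'rV[R]_n | `|y| <= M + 1].
  by apply: (@preimage_closed _ _ _ [set t : R | t <= M + 1]);
    [move=> ? _; exact: norm_continuous|exact: closed_le].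
by have := closureS AM zA; rewrite -(proj1 (closure_id _) clM).
Qed.

Lemma boundaryE (R : realType) n (Omega : set 'rV[R]_n) : open Omega ->
  boundary Omega = closure Omega `\` Omega.
Proof. by move=> /interior_id oO; rewrite /boundary oO. Qed.

(** If [u - w] were positive somewhere, its maximum over the compact set
    [closure Omega] cut with the closed ball would be positive, hence attained
    neither on the boundary of [Omega] nor on the sphere: it would be an
    interior local maximum. *)
Lemma comparison (R : realType) n (Omega : set 'rV[R]_n) (u w : 'rV[R]_n -> R)
    (y : 'rV[R]_n) (r : R) :
  open Omega -> bounded_set Omega -> {within closure Omega, continuous u} ->
  continuous w ->
  (forall x, boundary Omega x -> sqdist x y <= r -> u x <= w x) ->
  (forall x, Omega x -> sqdist x y = r -> u x <= w x) ->
  (forall x, Omega x -> sqdist x y < r ->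
    ~ \forall z \near x, u z - w z <= u x - w x) ->
  forall x, Omega x -> sqdist x y <= r -> u x <= w x.
Proof.
move=> oO bO cu cw ubd usph notouch x Ox xr.
pose K := closure Omega `&` [set z | sqdist z y <= r].
have clr : closed [set z : 'rV[R]_n | sqdist z y <= r].
  by apply: (@preimage_closed _ _ _ [set t : R | t <= r]);
    [move=> ? _; exact: continuous_sqdist|exact: closed_le].
have cK : compact K.
  apply: compact_closedI => //; exact: compact_closure_bounded.
have cuw : {within K, continuous (fun z => u z - w z)}.
  apply: (@continuous_subspaceW _ _ _ (closure Omega)); first by move=> ? [].
  by move=> z; apply: continuousB; [exact: cu|exact: continuous_subspaceT].
have OK z : Omega z -> sqdist z y <= r -> K z.
  by move=> Oz zr; split=> //; exact: subset_closure.
have K0 : K !=set0 by exists x; exact: OK.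
have [c] := compact_EVT_max K0 cK cuw.
rewrite inE => -[clc cr] cmax.
have cmaxle z : Omega z -> sqdist z y <= r -> u z - w z <= u c - w c.
  by move=> Oz zr; apply: cmax; rewrite inE; exact: OK.
suff ucw : u c <= w c by have := cmaxle x Ox xr; lra.
have [Oc|nOc] := pselect (Omega c); last first.
  by apply: ubd => //; rewrite boundaryE.
have := cr; rewrite /= le_eqVlt => /orP[/eqP|cr']; first exact: usph.
exfalso; apply: (notouch c Oc cr').
near=> z; apply: cmaxle; near: z; first exact: open_nbhs_nbhs.
by apply: filterS (sqdist_near cr') => z /ltW.
Unshelve. all: by end_near. Qed.

(** The derivatives of [w] are passed as the functions [w1] and numbers [w2], so
    that a barrier only has to be differentiated where [phi > 0]. *)
Lemma touching_derivatives (R : realType) n (Omega : set 'rV[R]_n)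
    (u w : 'rV[R]_n -> R) (w1 : 'I_n -> 'rV[R]_n -> R) (w2 : 'I_n -> R) x :
  open Omega -> Ck 2 Omega u -> Omega x ->
  (forall i, \forall y \near x, is_derive y (delta_mx 0 i) w (w1 i y)) ->
  (forall i, is_derive x (delta_mx 0 i) (w1 i) (w2 i)) ->
  (\forall z \near x, u z - w z <= u x - w x) ->
  (forall i, partial i u x = w1 i x) /\ laplacian u x <= \sum_(i < n) w2 i.
Proof.
move=> oO [_ C2u] Ox dw dw1 xmax.
have H i : partial i u x - w1 i x = 0 /\
    partial i (partial i u) x - w2 i <= 0.
  have [du [_ /(_ i)[ddu _]]] := C2u i.
  apply: (@directional_derivative_test _ _ (fun z => u z - w z)
    (fun z => partial i u z - w1 i z) _ x (delta_mx 0 i)) => //.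
  - have : \forall y \near x, Omega y by exact: open_nbhs_nbhs.
    move: (dw i); apply: filterS2 => z dwz Oz.
    by apply: is_deriveB; exact/derivableP/du.
  - by apply: is_deriveB; exact/derivableP/ddu.
split=> [i|]; first by have [/eqP] := H i; rewrite subr_eq0 => /eqP.
by apply: ler_sum => i _; rewrite -subr_le0; exact: (H i).2.
Qed.

Lemma is_derive_comp_real (R : realType) (V : normedModType R) (f : V -> R)
    (F : R -> R) (x v : V) (d e : R) :
  is_derive x v f d -> is_derive (f x) 1 F e ->
  is_derive x v (fun z => F (f z)) (e * d).
Proof.
move=> df dF.
have := @is_derive_lineE _ _ (F \o f) x v 0 (e * d).
rewrite scale0r addr0 => -[+ _]; apply.
apply: (@is_derive1_comp _ F (fun s => f (x + s *: v))).
  by rewrite scale0r addr0.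
by apply/is_derive_lineE; rewrite scale0r addr0.
Qed.

Lemma is_derive_sqdist (R : realType) n (x y : 'rV[R]_n) i :
  is_derive x (delta_mx 0 i) (fun z => sqdist z y) (2 * (x 0 i - y 0 i)).
Proof.
have := @is_derive_lineE _ _ (fun z => sqdist z y) x (delta_mx 0 i) 0
  (2 * (x 0 i - y 0 i)).
rewrite scale0r addr0 => -[+ _]; apply.
have -> : (fun s => sqdist (x + s *: delta_mx 0 i) y) =
    (fun s => s ^+ 2 + (2 * (x 0 i - y 0 i)) * s + sqdist x y).
  apply/funext => s; rewrite /sqdist [in LHS](bigD1 i)//= [in RHS](bigD1 i)//=.
  rewrite (eq_bigr (fun j => (x 0 j - y 0 j) ^+ 2)) => [|j /negPf ji].
    by rewrite !mxE !eqxx/=; ring.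
  by rewrite !mxE eqxx ji/= mulr0 addr0.
apply: is_derive_eq.
by rewrite /GRing.scale/=; ring.
Qed.

(** * Barriers built on a defining function *)

(** Trades the sublinear gradient term for an affine one, which scales along
    with the barriers. *)
Lemma powR_le1D (R : realType) (a e : R) : 0 < a < 1 -> 0 <= e -> e `^ a <= 1 + e.
Proof.
move=> /andP[a0 a1] e0; have [e1|/ltW e1] := leP e 1.
  have : e `^ a <= 1 `^ a by rewrite ge0_ler_powR ?nnegrE// ltW.
  by rewrite powR1; lra.
by have := ler_powR e1 (ltW a1); rewrite powRr1//; lra.
Qed.

Definition barrier (R : realType) n (A : R) (y : 'rV[R]_n) (F : R -> R)
    (phi : 'rV[R]_n -> R) (x : 'rV[R]_n) : R :=
  A * sqdist x y + F (phi x).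

Lemma continuous_barrier (R : realType) n (A : R) (y : 'rV[R]_n) (F : R -> R)
    (phi : 'rV[R]_n -> R) :
  continuous F -> continuous phi -> continuous (barrier A y F phi).
Proof.
move=> cF cphi x; apply: (@continuousD _ _ _ (fun x => A * sqdist x y)).
  apply: (@continuousM _ _ (fun=> A)); first exact: cst_continuous.
  exact: continuous_sqdist.
by apply: continuous_comp; [exact: cphi|exact: cF].
Qed.

Section BarrierTouching.
Variables (R : realType) (n : nat) (Omega : set 'rV[R]_n) (u : 'rV[R]_n -> R).
Variables (phi : 'rV[R]_n -> R) (F F1 F2 : R -> R) (A : R) (x y : 'rV[R]_n).
Hypotheses (oO : open Omega) (C2u : Ck 2 Omega u) (Ox : Omega x).
Hypothesis cphi : {for x, continuous phi}.
Hypothesis dphi : forall z i, derivable phi z (delta_mx 0 i).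
Hypothesis ddphi : forall i, derivable (partial i phi) x (delta_mx 0 i).
Hypothesis phi0 : 0 < phi x.
Hypothesis dF : forall s : R, 0 < s -> is_derive s 1 F (F1 s).
Hypothesis dF1 : forall s : R, 0 < s -> is_derive s 1 F1 (F2 s).
Hypothesis xmax :
  \forall z \near x, u z - barrier A y F phi z <= u x - barrier A y F phi x.

(** Chain rule: the gradient of the barrier is
    [2 A (x - y) + F'(phi) grad phi] and its Laplacian is
    [2 n A + F''(phi) |grad phi|^2 + F'(phi) Delta phi]. *)
Lemma barrier_touching :
  (forall i, partial i u x = 2 * A * (x 0 i - y 0 i) + F1 (phi x) * partial i phi x) /\
  laplacian u x <= 2 * n%:R * A + F2 (phi x) * (\sum_(i < n) partial i phi x ^+ 2)
    + F1 (phi x) * laplacian phi x.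
Proof.
pose w1 (i : 'I_n) (z : 'rV[R]_n) :=
  2 * A * (z 0 i - y 0 i) + F1 (phi z) * partial i phi z.
pose w2 (i : 'I_n) := 2 * A + (F2 (phi x) * partial i phi x ^+ 2 +
  F1 (phi x) * partial i (partial i phi) x).
have [|||gradE lapE] :=
  @touching_derivatives _ _ Omega u (barrier A y F phi) w1 w2 x oO C2u Ox.
- move=> i; have : \forall z \near x, 0 < phi z by apply: cvgr_gt cphi _ phi0.
  apply: filterS => z phiz; rewrite /w1.
  have d1 := is_deriveZ A (is_derive_sqdist z y i).
  have d0 : is_derive z (delta_mx 0 i) phi (partial i phi z) by exact/derivableP.
  have d2 := is_derive_comp_real d0 (dF phiz).
  apply: is_derive_eq (is_deriveD d1 d2) _.
  by rewrite /w1 /GRing.scale/= /partial; ring.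
- move=> i.
  have d0 : is_derive x (delta_mx 0 i) phi (partial i phi x) by exact/derivableP.
  have dd0 : is_derive x (delta_mx 0 i) (partial i phi)
    (partial i (partial i phi) x) by exact/derivableP.
  have d3 := is_deriveM (is_derive_comp_real d0 (dF1 phi0)) dd0.
  pose lin (z : 'rV[R]_n) := 2 * A * (z 0 i - y 0 i).
  have d1 : is_derive x (delta_mx 0 i : 'rV[R]_n) lin (2 * A).
    have := @is_derive_lineE _ _ lin x (delta_mx 0 i) 0 (2 * A).
    rewrite scale0r addr0 => -[+ _]; apply.
    have -> : (fun s => lin (x + s *: delta_mx 0 i)) =
        (fun s => (2 * A) * s + 2 * A * (x 0 i - y 0 i)).
      by apply/funext => s; rewrite /lin !mxE !eqxx/=; ring.
    by apply: is_derive_eq; rewrite /GRing.scale/=; ring.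
  apply: is_derive_eq (is_deriveD d1 d3) _.
  by rewrite /w2 /GRing.scale/= /partial; ring.
- exact: xmax.
split=> //; apply: le_trans lapE _.
rewrite /w2 !big_split/= -!mulr_sumr sumr_const card_ord.
by rewrite -[A *+ n]mulr_natr addrA lerD2r mulrA mulrAC.
Qed.

Lemma barrier_touching_le (a M rho L : R) : 0 < a < 1 -> 0 <= M -> 0 <= A ->
  0 <= rho -> sqdist x y <= rho ^+ 2 ->
  (forall i, `|partial i phi x| <= L) ->
  (forall i, `|partial i (partial i phi) x| <= L) ->
  laplacian u x + M * enorm (grad u x) `^ a <=
    2 * n%:R * A + F2 (phi x) * (\sum_(i < n) partial i phi x ^+ 2)
    + n%:R * L * `|F1 (phi x)|
    + M * (1 + n%:R * (2 * A * rho + L * `|F1 (phi x)|)).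
Proof.
move=> a01 M0 A0 rho0 xy b1 b2; have [gradE lapE] := barrier_touching.
have lap : F1 (phi x) * laplacian phi x <= n%:R * L * `|F1 (phi x)|.
  apply: le_trans (ler_norm _) _; rewrite normrM mulrC ler_wpM2r//.
  apply: le_trans (ler_norm_sum _ _ _) _.
  apply: le_trans (ler_sum _ (fun i _ => b2 i)) _.
  by rewrite sumr_const card_ord -[L *+ n]mulr_natl.
have gr : enorm (grad u x) <= n%:R * (2 * A * rho + L * `|F1 (phi x)|).
  apply: le_trans (enorm_le_sum _) _.
  rewrite -[X in X%:R * _](card_ord n) mulr_natl -sumr_const.
  apply: ler_sum => i _; rewrite mxE gradE.
  apply: le_trans (ler_normD _ _) _; apply: lerD.
    rewrite normrM ger0_norm ?mulr_ge0// ler_wpM2l ?mulr_ge0//.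
    rewrite -ler_sqr ?nnegrE// real_normK ?num_real//.
    by apply: le_trans xy; exact: ler_coord_sqdist.
  by rewrite normrM mulrC ler_wpM2r.
have e0 : 0 <= enorm (grad u x) by exact: sqrtr_ge0.
have := ler_wpM2l M0 (le_trans (powR_le1D a01 e0) (lerD (lexx 1) gr)).
lra.
Qed.

End BarrierTouching.

(** * Boundary charts *)

Lemma lipschitz_along_line (R : realType) n (f : 'rV[R]_n -> R) (x : 'rV[R]_n)
    (i : 'I_n) (c L : R) :
  (forall t : R, 0 <= t <= 1 ->
    derivable f (x + (t * c) *: delta_mx 0 i) (delta_mx 0 i)) ->
  (forall t : R, 0 <= t <= 1 -> `|partial i f (x + (t * c) *: delta_mx 0 i)| <= L) ->
  `|f (x + c *: delta_mx 0 i) - f x| <= L * `|c|.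
Proof.
move=> df fL; pose v : 'rV[R]_n := delta_mx 0 i.
pose g t := f (x + (t * c) *: v); pose dg t := partial i f (x + (t * c) *: v) * c.
have Dg (t : R) : 0 <= t <= 1 -> is_derive t 1 g (dg t).
  move=> t01.
  have dlin : is_derive t 1 (fun s : R => s * c) c.
    have -> : (fun s : R => s * c) = (fun s => c * s) by apply/funext => s; exact: mulrC.
    by apply: is_derive_eq; rewrite /GRing.scale/= mulr1.
  apply: (@is_derive1_comp _ (fun s => f (x + s *: v)) (fun s => s * c)) => //.
  by apply/is_derive_lineE; apply/derivableP/df.
have cg : {within `[0, 1], continuous g}.
  apply: derivable_within_continuous => t; rewrite in_itv/= => t01.
  by have [] := Dg t t01.
have [t|t] := @MVT _ g dg 0 1 ltr01 _ cg.
  by rewrite in_itv/= => /andP[/ltW t0 /ltW t1]; apply: Dg; rewrite t0.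
rewrite in_itv/= => /andP[/ltW t0 /ltW t1].
rewrite {1 2}/g mul1r mul0r scale0r addr0 subr0 mulr1 => ->.
by rewrite /dg normrM ler_wpM2r// fL// t0.
Qed.

(** Only partial derivatives are controlled, so one moves from [z] to [x] by
    changing one coordinate at a time; the hybrid points have squared distance
    to [x0] at most [sqdist x x0 + sqdist z x0], whence the factor 2. *)
Lemma lipschitz_of_partials (R : realType) n (f : 'rV[R]_n -> R)
    (x0 : 'rV[R]_n) (r L : R) :
  (forall x i, sqdist x x0 < 2 * r -> derivable f x (delta_mx 0 i)) ->
  (forall x i, sqdist x x0 < 2 * r -> `|partial i f x| <= L) ->
  forall x z, sqdist x x0 < r -> sqdist z x0 < r ->
    `|f x - f z| <= L * \sum_(i < n) `|x 0 i - z 0 i|.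
Proof.
move=> df fL x z xr zr.
pose hyb k : 'rV[R]_n := \row_j (if (j < k)%N then x 0 j else z 0 j).
suff H k : (k <= n)%N ->
    `|f (hyb k) - f z| <= L * \sum_(i < n | (i < k)%N) `|x 0 i - z 0 i|.
  have -> : x = hyb n by apply/rowP => j; rewrite !mxE ltn_ord.
  apply: le_trans (H n (leqnn n)) _.
  rewrite (eq_bigl xpredT) => [|i]; last by rewrite ltn_ord.
  by under [X in _ <= _ * X]eq_bigr do rewrite mxE ltn_ord.
elim: k => [_|k IH kn].
  have -> : hyb 0%N = z by apply/rowP => j; rewrite !mxE.
  by rewrite subrr normr0 big_pred0 ?mulr0.
pose i := Ordinal kn; pose c := x 0 i - z 0 i.
have hybE : hyb k.+1 = hyb k + c *: delta_mx 0 i.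
  apply/rowP => j; rewrite !mxE eqxx/=.
  have [->|ji] := eqVneq j i; first by rewrite /= ltnSn ltnn mulr1 addrC subrK.
  rewrite mulr0 addr0 ltnS leq_eqVlt.
  by rewrite -[(j == k :> nat)]/(j == i) (negPf ji).
have near_hyb (t : R) : 0 <= t <= 1 ->
    sqdist (hyb k + (t * c) *: delta_mx 0 i) x0 < 2 * r.
  move=> /andP[t0 t1].
  apply: (@le_lt_trans _ _ (sqdist x x0 + sqdist z x0)); last by lra.
  rewrite /sqdist -big_split/=; apply: ler_sum => j _; rewrite !mxE eqxx/=.
  have [->|_] := eqVneq j i.
    rewrite ltnn mulr1 /c.
    set a := x 0 i; set b := z 0 i; set d := x0 0 i.
    have -> : b + t * (a - b) - d = t * (a - d) + (1 - t) * (b - d) by ring.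
    move: (a - d) (b - d) => p q; have t1' : 0 <= 1 - t by lra.
    have := mulr_ge0 (mulr_ge0 t0 t1') (sqr_ge0 (p - q)).
    have := mulr_ge0 t1' (sqr_ge0 p); have := mulr_ge0 t0 (sqr_ge0 q).
    by rewrite !expr2; lra.
  rewrite mulr0 addr0.
  have := sqr_ge0 (x 0 j - x0 0 j); have := sqr_ge0 (z 0 j - x0 0 j).
  by case: ifP => _; lra.
have := @lipschitz_along_line _ _ f (hyb k) i c L (fun t ht => df _ i (near_hyb t ht))
  (fun t ht => fL _ i (near_hyb t ht)).
rewrite -hybE => step.
rewrite (bigD1 i)//= mulrDr.
have -> : \sum_(j < n | (j < k.+1)%N && (j != i)) `|x 0 j - z 0 j| =
    \sum_(j < n | (j < k)%N) `|x 0 j - z 0 j|.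
  apply: eq_bigl => j; rewrite ltnS leq_eqVlt.
  rewrite -[(j == k :> nat)]/(j == i); have [->|] := eqVneq j i; last by rewrite andbT.
  by rewrite /= ltnn.
have := IH (ltnW kn); have := ler_normD (f (hyb k.+1) - f (hyb k)) (f (hyb k) - f z).
by rewrite addrA subrK; rewrite -/c; lra.
Qed.

(** [phi] is a defining function of [Omega] in the ball of radius [r] around
    [x0], and [e] is a unit vector along which [phi] has slope 1. *)
Record boundary_chart (R : realType) n (Omega : set 'rV[R]_n) (x0 : 'rV[R]_n)
    (phi : 'rV[R]_n -> R) (e : 'rV[R]_n) (L r : R) : Prop := BoundaryChart {
  chart_continuous : continuous phi;
  chart_derivable : forall x i, derivable phi x (delta_mx 0 i);
  chart_derivable2 : forall x i, derivable (partial i phi) x (delta_mx 0 i);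
  chart_vertical : forall x t, phi (x + t *: e) = phi x + t;
  chart_unit : forall x t, sqdist (x + t *: e) x = t ^+ 2;
  chart_radius : 0 < r;
  chart_bound : 1 <= L;
  chart_domain : forall x, sqdist x x0 < r ^+ 2 -> (Omega x <-> 0 < phi x);
  chart_partial : forall x i, sqdist x x0 < r ^+ 2 -> `|partial i phi x| <= L;
  chart_partial2 : forall x i, sqdist x x0 < r ^+ 2 ->
    `|partial i (partial i phi) x| <= L;
  chart_gradient : forall x, 1 <= \sum_(i < n) partial i phi x ^+ 2
}.

Section Chart.
Variables (R : realType) (n : nat) (Omega : set 'rV[R]_n) (x0 : 'rV[R]_n).
Variables (phi : 'rV[R]_n -> R) (e : 'rV[R]_n) (L r : R).
Hypotheses (oO : open Omega) (bx0 : boundary Omega x0).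
Hypothesis chart : boundary_chart Omega x0 phi e L r.

Lemma chart_closure_ge0 x : closure Omega x -> sqdist x x0 < r ^+ 2 -> 0 <= phi x.
Proof.
move=> clx xr; rewrite leNgt; apply/negP => phix.
have [z [Oz [zphi zr]]] : Omega `&` [set z | phi z < 0 /\ sqdist z x0 < r ^+ 2] !=set0.
  apply: clx; near=> z; split; near: z; last exact: sqdist_near.
  have cx : phi z @[z --> x] --> phi x by exact: (chart_continuous chart).
  exact: (cvgr_lt _ cx _ phix).
by have := (chart_domain chart zr).1 Oz; lra.
Unshelve. all: by end_near. Qed.

Lemma chart_boundary_eq0 x : boundary Omega x -> sqdist x x0 < r ^+ 2 -> phi x = 0.
Proof.
rewrite boundaryE// => -[clx nOx] xr; apply/eqP.
rewrite eq_le chart_closure_ge0// andbT leNgt; apply/negP => phi0.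
exact/nOx/(chart_domain chart xr).
Qed.

(** Pushing a zero of [phi] along [e] makes [phi] positive at once, so zeros are
    limits of points of [Omega]. *)
Lemma chart_zero_boundary x : phi x = 0 -> sqdist x x0 < r ^+ 2 -> boundary Omega x.
Proof.
move=> phix xr; rewrite boundaryE//; split=> [U nU|]; last first.
  by move=> /(chart_domain chart xr); rewrite phix ltxx.
have : \forall z \near x, U z /\ sqdist z x0 < r ^+ 2.
  by near=> z; split; near: z => //; exact: sqdist_near.
move=> /(near_line e) [d /= d0 H].
have [|Ux xr'] := H (d / 2).
  by rewrite /ball_/= sub0r normrN ger0_norm ?divr_ge0 ?ltW//; lra.
exists (x + (d / 2) *: e); split=> //.
by apply/(chart_domain chart xr'); rewrite (chart_vertical chart) phix add0r; lra.
Unshelve. all: by end_near. Qed.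

(** Sliding down from a point of the domain by its height reaches the
    boundary. *)
Lemma chart_foot x : sqdist x x0 < r ^+ 2 / 4 -> phi x ^+ 2 < r ^+ 2 / 4 ->
  boundary Omega (x - phi x *: e).
Proof.
move=> xr phir; apply: chart_zero_boundary.
  by rewrite -scaleNr (chart_vertical chart) subrr.
have := sqdist_triangle (x - phi x *: e) x x0.
by rewrite -scaleNr (chart_unit chart) sqrrN; lra.
Qed.

Lemma chart_lipschitz x z : sqdist x x0 < r ^+ 2 / 2 -> sqdist z x0 < r ^+ 2 / 2 ->
  `|phi x - phi z| <= L * \sum_(i < n) `|x 0 i - z 0 i|.
Proof.
apply: lipschitz_of_partials => y i yr.
  exact: (chart_derivable chart).
by apply: (chart_partial chart); move: yr; lra.
Qed.

Lemma bdist_le_chart x : sqdist x x0 < r ^+ 2 / 4 -> phi x ^+ 2 < r ^+ 2 / 4 ->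
  0 <= phi x -> bdist Omega x <= phi x.
Proof.
move=> xr phir phi0; apply: ge_inf.
  by exists 0 => _ [y _ <-]; exact: sqrtr_ge0.
exists (x - phi x *: e); first exact: chart_foot.
rewrite enorm_sqdist sqdistC -scaleNr (chart_unit chart) sqrrN sqrtr_sqr.
by rewrite ger0_norm.
Qed.

(** Boundary points in the ball are zeros of [phi], so the Lipschitz bound
    applies to them; those outside are farther away than [phi x], which is
    small. *)
Lemma chart_le_bdist x : (0 < n)%N -> Omega x -> sqdist x x0 < r ^+ 2 / 16 ->
  phi x ^+ 2 < r ^+ 2 / 16 -> phi x <= n%:R * L * bdist Omega x.
Proof.
move=> n0 Ox xr phir.
have r0 := chart_radius chart; have L1 := chart_bound chart.
have r20 : 0 < r ^+ 2 by rewrite exprn_gt0.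
have n1 : 1 <= n%:R :> R by rewrite ler1n.
have nL0 : 0 < n%:R * L by apply: mulr_gt0; lra.
rewrite mulrC -ler_pdivrMr//; apply: lb_le_inf.
  by exists (enorm (x - x0)); exists x0.
move=> _ [z bz <-]; rewrite ler_pdivrMr//.
have [zr|zr] := ltP (sqdist z x0) (r ^+ 2 / 2).
  have phiz : phi z = 0 by apply: chart_boundary_eq0 => //; lra.
  have xr2 : sqdist x x0 < r ^+ 2 / 2 by lra.
  have := chart_lipschitz xr2 zr.
  rewrite phiz subr0 => H.
  have S : \sum_(i < n) `|x 0 i - z 0 i| <= n%:R * enorm (x - z).
    rewrite -[X in X%:R * _](card_ord n) mulr_natl -sumr_const.
    by apply: ler_sum => i _; exact: ler_coord_enorm.
  have L0 : 0 <= L by lra.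
  by have := ler_wpM2l L0 S; have := ler_norm (phi x); lra.
have xz : phi x ^+ 2 <= sqdist x z.
  by have := sqdist_triangle z x x0; rewrite (sqdistC z x); lra.
have phixz : phi x <= enorm (x - z).
  by apply: le_trans (ler_norm _) _; rewrite -sqrtr_sqr enorm_sqdist ler_wsqrtr.
apply: le_trans phixz _; rewrite ler_peMr ?sqrtr_ge0//.
by apply: le_trans n1 _; rewrite ler_peMr// ltW// ltr0n.
Qed.

Lemma chart_center : phi x0 = 0.
Proof.
apply: chart_boundary_eq0 => //.
by rewrite sqdistxx exprn_gt0// (chart_radius chart).
Qed.

Lemma near_chart (d : R) : 0 < d -> \forall x \near x0,
  [/\ `|phi x| < d, sqdist x x0 < d ^+ 2 & sqdist x x0 < r ^+ 2].
Proof.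
move=> d0.
have n1 : \forall x \near x0, `|phi x| < d.
  have cx : `|phi z| @[z --> x0] --> `|phi x0|.
    have c0 : phi z @[z --> x0] --> phi x0 by exact: (chart_continuous chart).
    exact: (cvg_norm c0).
  by apply: (cvgr_lt _ cx); rewrite chart_center normr0.
have n2 (t : R) : 0 < t -> \forall x \near x0, sqdist x x0 < t ^+ 2.
  by move=> t0; apply: sqdist_near; rewrite sqdistxx exprn_gt0.
apply: filterS (filterI n1 (filterI (n2 d d0) (n2 r (chart_radius chart)))).
by move=> x [? []].
Qed.

End Chart.

(** * Charts at smooth boundary points *)

(** A directional derivative only sees the line through the point, so it can be
    pulled back along any map that is affine on that line. *)
Lemma is_derive_comp_linear (R : realType) (V W : normedModType R) (M : V -> W)
    (f : W -> R) (x v : V) (d : R) :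
  (forall t, M (x + t *: v) = M x + t *: M v) ->
  is_derive (M x) (M v) f d -> is_derive x v (fun z => f (M z)) d.
Proof.
move=> Mlin df.
have := @is_derive_lineE _ _ (fun z => f (M z)) x v 0 d.
rewrite scale0r addr0 => -[+ _]; apply.
under eq_fun do rewrite Mlin.
by apply/is_derive_lineE; rewrite scale0r addr0.
Qed.

Section Graph.
Variables (R : realType) (n : nat) (i : 'I_n.+1).
Implicit Types (x v : 'rV[R]_n.+1) (j : 'I_n.+1).

Lemma col'_affine x v t : col' i (x + t *: v) = col' i x + t *: col' i v.
Proof. by apply/rowP => k; rewrite !mxE. Qed.

Lemma col'_delta j : col' i (delta_mx 0 j : 'rV[R]_n.+1) =
  if unlift i j is Some k then delta_mx 0 k else 0.
Proof.
apply/rowP => k; rewrite !mxE eqxx/=.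
case: unliftP => [k' ->|->]; rewrite !mxE ?eqxx/= ?(inj_eq (@lift_inj _ i))//.
by rewrite eq_sym (negPf (neq_lift _ _)).
Qed.

Lemma continuous_col' : continuous (fun x => col' i x : 'rV[R]_n).
Proof.
move=> x P /near_sqdist[r r0 H].
have : sqdist x x < r ^+ 2 by rewrite sqdistxx exprn_gt0.
move/sqdist_near; apply: filterS => y yx; apply: H.
apply: le_lt_trans yx; rewrite /sqdist [leRHS](bigD1_ord i)//=.
under eq_bigr do rewrite !mxE.
by rewrite lerDr sqr_ge0.
Qed.

Lemma is_derive_coord j x v : is_derive x v (fun z : 'rV[R]_n.+1 => z 0 j) (v 0 j).
Proof.
apply: (@is_derive_comp_linear _ _ _ (fun z : 'rV[R]_n.+1 => z 0 j) id).
by move=> t; rewrite !mxE.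
Qed.

Variable (h : 'rV[R]_n -> R).
Hypothesis Ch : Ck 2 setT h.

(** The partial derivatives of [fun x => h (col' i x)]: the one along the
    vertical axis [i] vanishes, since [col'] forgets that coordinate. *)
Definition graph_partial j (y : 'rV[R]_n) : R :=
  if unlift i j is Some k then partial k h y else 0.

Definition graph_partial2 j (y : 'rV[R]_n) : R :=
  if unlift i j is Some k then partial k (partial k h) y else 0.

Lemma is_derive_graph j x :
  is_derive x (delta_mx 0 j) (fun z => h (col' i z)) (graph_partial j (col' i x)).
Proof.
apply: is_derive_comp_linear => [t|]; first exact: col'_affine.
rewrite col'_delta /graph_partial; case: (unlift i j) => [k|].
  by apply/derivableP; have [_ /(_ k)[/(_ (col' i x) I)]] := Ch.
exact: is_derive0.
Qed.

Lemma is_derive_graph_partial j x :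
  is_derive x (delta_mx 0 j) (fun z => graph_partial j (col' i z))
    (graph_partial2 j (col' i x)).
Proof.
apply: is_derive_comp_linear => [t|]; first exact: col'_affine.
rewrite col'_delta /graph_partial /graph_partial2; case: (unlift i j) => [k|].
  by apply/derivableP; have [_ /(_ k)[_ [_ /(_ k)[/(_ (col' i x) I)]]]] := Ch.
exact: is_derive0.
Qed.

Lemma continuous_graph_partial j : continuous (fun z => graph_partial j (col' i z)).
Proof.
move=> x; rewrite /graph_partial; case: (unlift i j) => [k|]; last exact: cst_continuous.
apply: continuous_comp; first exact: continuous_col'.
by have [_ /(_ k)[_ [/(_ (col' i x) I) + _]]] := Ch.
Qed.

Lemma continuous_graph_partial2 j : continuous (fun z => graph_partial2 j (col' i z)).
Proof.
move=> x; rewrite /graph_partial2; case: (unlift i j) => [k|]; last exact: cst_continuous.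
apply: continuous_comp; first exact: continuous_col'.
by have [_ /(_ k)[_ [_ /(_ k)[_ [/(_ (col' i x) I) + _]]]]] := Ch.
Qed.

Variable s : R.
Hypothesis ss : s * s = 1.

(** [s] is 1 or -1, according to the side of the graph on which [Omega] lies. *)
Definition height x : R := s * (x 0 i - h (col' i x)).

Lemma is_derive_height j x : is_derive x (delta_mx 0 j) height
  (s * ((i == j)%:R - graph_partial j (col' i x))).
Proof.
have d1 := is_deriveB (is_derive_coord i x (delta_mx 0 j)) (is_derive_graph j x).
apply: is_derive_eq (is_deriveZ s d1) _.
by rewrite mxE eqxx.
Qed.

Lemma partial_height j : partial j height =
  fun x => s * ((i == j)%:R - graph_partial j (col' i x)).
Proof. by apply/funext => x; have [] := is_derive_height j x. Qed.

Lemma is_derive_partial_height j x : is_derive x (delta_mx 0 j) (partial j height)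
  (- s * graph_partial2 j (col' i x)).
Proof.
rewrite partial_height.
have d1 := is_deriveB (is_derive_cst ((i == j)%:R : R) x (delta_mx 0 j))
  (is_derive_graph_partial j x).
by apply: is_derive_eq (is_deriveZ s d1) _; rewrite sub0r /GRing.scale/= mulrN mulNr.
Qed.

Lemma partial2_height j : partial j (partial j height) =
  fun x => - s * graph_partial2 j (col' i x).
Proof. by apply/funext => x; have [] := is_derive_partial_height j x. Qed.

Lemma continuous_height : continuous height.
Proof.
move=> x; apply: (@continuousM _ _ (fun=> s) (fun x => x 0 i - h (col' i x))).
  exact: cst_continuous.
apply: continuousB; first exact: coord_continuous.
apply: continuous_comp; first exact: continuous_col'.
by case: Ch => + _; apply.
Qed.

Lemma continuous_partial_height j : continuous (partial j height).
Proof.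
rewrite partial_height; pose c : R := (i == j)%:R => x.
apply: (@continuousM _ _ (fun=> s) (fun x => c - graph_partial j (col' i x))).
  exact: cst_continuous.
apply: (@continuousB _ R^o _ (fun=> c) (fun x => graph_partial j (col' i x))).
  exact: cst_continuous.
exact: continuous_graph_partial.
Qed.

Lemma continuous_partial2_height j : continuous (partial j (partial j height)).
Proof.
rewrite partial2_height => x.
apply: (@continuousM _ _ (fun=> - s) (fun x => graph_partial2 j (col' i x))).
  exact: cst_continuous.
exact: continuous_graph_partial2.
Qed.

Lemma height_vertical x t : height (x + t *: (s *: delta_mx 0 i)) = height x + t.
Proof.
rewrite /height scalerA col'_affine col'_delta unlift_none scaler0 addr0.
by rewrite !mxE !eqxx mulr1 -[t in RHS]mul1r -ss; ring.
Qed.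

Lemma height_gradient x : 1 <= \sum_j partial j height x ^+ 2.
Proof.
rewrite (bigD1 i)//= partial_height eqxx /graph_partial.
rewrite unlift_none subr0 mulr1 [s ^+ 2]expr2 ss lerDl.
by apply: sumr_ge0 => j _; exact: sqr_ge0.
Qed.

End Graph.

Lemma near_bounded_finite (R : realType) (T : topologicalType) (I : finType)
    (f : I -> T -> R) (x : T) (L : R) :
  (forall j, {for x, continuous (f j)}) -> (forall j, `|f j x| < L) ->
  \forall z \near x, forall j, `|f j z| < L.
Proof.
move=> cf fL; apply: filter_forall => j.
have : `|f j z| @[z --> x] --> `|f j x| by apply: cvg_norm; exact: cf.
by move/cvgr_lt; apply.
Qed.

(** The defining function is the signed height above the graph; its derivatives
    are continuous, so they are bounded after shrinking the radius. *)
Lemma exists_boundary_chart (R : realType) N (Omega : set 'rV[R]_N.+1) x0 :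
  smooth_boundary Omega -> boundary Omega x0 ->
  exists phi e L r, boundary_chart Omega x0 phi e L r.
Proof.
move=> sm /sm[r [i [b [h [r0 smh dom]]]]].
have Ch : Ck 2 setT h := smh 2%N.
pose s : R := (-1) ^+ b.
have ss : s * s = 1 by rewrite -expr2 sqrr_sign.
pose phi := height i h s.
pose L := 1 + \sum_j (`|partial j phi x0| + `|partial j (partial j phi) x0|).
have sum_ge0 (P : pred 'I_N.+1) : 0 <=
    \sum_(j | P j) (`|partial j phi x0| + `|partial j (partial j phi) x0|).
  by apply: sumr_ge0 => j _; rewrite addr_ge0.
have L1 j : `|partial j phi x0| + `|partial j (partial j phi) x0| < L.
  rewrite /L (bigD1 j)//=.
  by have := sum_ge0 (predC1 j); rewrite /=; lra.
have near1 : \forall z \near x0, forall j, `|partial j phi z| < L.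
  apply: (@near_bounded_finite _ _ _ (fun j => partial j phi)) => j.
    exact: continuous_partial_height.
  by have := L1 j; have := normr_ge0 (partial j (partial j phi) x0); lra.
have near2 : \forall z \near x0, forall j, `|partial j (partial j phi) z| < L.
  apply: (@near_bounded_finite _ _ _ (fun j => partial j (partial j phi))) => j.
    exact: continuous_partial2_height.
  by have := L1 j; have := normr_ge0 (partial j phi x0); lra.
have [r' r'0 Hr'] := near_sqdist (filterI near1 near2).
pose rho := Num.min r r'.
have rho0 : 0 < rho by rewrite lt_min r0 r'0.
have rho_r : rho ^+ 2 <= r ^+ 2.
  by rewrite ler_sqr ?nnegrE ?(ltW rho0) ?(ltW r0)// /rho ge_min lexx.
have rho_r' : rho ^+ 2 <= r' ^+ 2.
  by rewrite ler_sqr ?nnegrE ?(ltW rho0) ?(ltW r'0)// /rho ge_min lexx orbT.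
exists phi, (s *: delta_mx 0 i), L, rho; split => //.
- exact: continuous_height.
- by move=> x j; have [] := is_derive_height i Ch s j x.
- by move=> x j; have [] := is_derive_partial_height i Ch s j x.
- exact: height_vertical.
- by move=> x t; rewrite scalerA sqdist_addl exprMn [s ^+ 2]expr2 ss mulr1.
- by rewrite /L lerDl; exact: sum_ge0.
- move=> x xr; have xr1 : eball x0 r x.
    by apply/eball_sqdist => //; apply: lt_le_trans xr rho_r.
  have E := congr1 (fun S => S x) dom.
  rewrite /= /setI/= in E.
  split=> [Ox|px].
    by have : Omega x /\ eball x0 r x by []; rewrite E => -[].
  have : (0 < phi x) /\ eball x0 r x by [].
  by rewrite /phi /height -[_ /\ _]E => -[].
- by move=> x j xr; apply/ltW/(Hr' _ (lt_le_trans xr rho_r')).1.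
- by move=> x j xr; apply/ltW/(Hr' _ (lt_le_trans xr rho_r')).2.
- exact: height_gradient.
Qed.

(** A point of the closure with the largest first coordinate cannot be interior. *)
Lemma exists_boundary (R : realType) n (Omega : set 'rV[R]_n.+1) :
  open Omega -> bounded_set Omega -> Omega !=set0 -> boundary Omega !=set0.
Proof.
move=> oO bO [x Ox].
have clO : closure Omega !=set0 by exists x; exact: subset_closure.
have cc : {within closure Omega, continuous (fun z : 'rV[R]_n.+1 => z 0 0)}.
  by apply: continuous_subspaceT => z; exact: coord_continuous.
have [c] := compact_EVT_max clO (compact_closure_bounded bO) cc.
rewrite inE => clc cmax; exists c; rewrite boundaryE//; split=> // Oc.
have : \forall z \near c, Omega z by exact: open_nbhs_nbhs.
move=> /(near_line (delta_mx 0 0)) [d /= d0 H].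
have := cmax (c + (d / 2) *: delta_mx 0 0).
rewrite inE !mxE !eqxx mulr1 => /(_ _)/wrap[].
  apply: subset_closure; apply: H.
  by rewrite /ball_/= sub0r normrN ger0_norm ?divr_ge0 ?ltW//; lra.
by apply/negP; rewrite -ltNge ltrDl divr_gt0.
Qed.

(** * Linear growth at the boundary *)

Lemma chart_touching_le (R : realType) n (Omega : set 'rV[R]_n)
    (x0 : 'rV[R]_n) (phi : 'rV[R]_n -> R) (e : 'rV[R]_n) (L r : R)
    (u : 'rV[R]_n -> R) (F F1 F2 : R -> R) (A : R) (y z : 'rV[R]_n) (a M rho : R) :
  open Omega -> boundary_chart Omega x0 phi e L r -> Ck 2 Omega u ->
  (forall s : R, 0 < s -> is_derive s 1 F (F1 s)) ->
  (forall s : R, 0 < s -> is_derive s 1 F1 (F2 s)) ->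
  0 < a < 1 -> 0 <= M -> 0 <= A -> 0 <= rho ->
  Omega z -> sqdist z x0 < r ^+ 2 -> sqdist z y <= rho ^+ 2 ->
  (\forall z' \near z, u z' - barrier A y F phi z' <= u z - barrier A y F phi z) ->
  laplacian u z + M * enorm (grad u z) `^ a <=
    2 * n%:R * A + F2 (phi z) * (\sum_(i < n) partial i phi z ^+ 2)
    + n%:R * L * `|F1 (phi z)|
    + M * (1 + n%:R * (2 * A * rho + L * `|F1 (phi z)|)).
Proof.
move=> oO chart C2u dF dF1 a01 M0 A0 rho0 Oz zr zy zmax.
apply: (barrier_touching_le oO C2u Oz _ _ _ _ dF dF1 zmax) => //.
- exact: (chart_continuous chart).
- by move=> w i; exact: (chart_derivable chart).
- by move=> i; exact: (chart_derivable2 chart).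
- exact/(chart_domain chart zr).
- by move=> i; exact: (chart_partial chart).
- by move=> i; exact: (chart_partial2 chart).
Qed.

Section LinearBound.
Variables (R : realType) (n : nat) (Omega : set 'rV[R]_n) (x0 : 'rV[R]_n).
Variables (phi : 'rV[R]_n -> R) (e : 'rV[R]_n) (L r : R).
Hypotheses (oO : open Omega) (bO : bounded_set Omega) (bx0 : boundary Omega x0).
Hypothesis chart : boundary_chart Omega x0 phi e L r.
Variables (u : 'rV[R]_n -> R) (a M : R).
Hypotheses (C2u : Ck 2 Omega u) (cu : {within closure Omega, continuous u}).
Hypothesis u0 : forall x, boundary Omega x -> u x = 0.
Hypotheses (a01 : 0 < a < 1) (M0 : 0 <= M).

(** The barrier is centred at the foot [y] of [x], with a radius and constants
    independent of [x]. Its quadratic part dominates [u] on the sphere, the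
    coefficient [k] makes it a strict supersolution, and at [x], which lies
    vertically above [y], it is of order [phi x]. *)
Lemma linear_bound :
  (\forall x \near x0, Omega x ->
     0 <= laplacian u x + M * enorm (grad u x) `^ a) ->
  exists2 C : R, 0 < C & \forall x \near x0, Omega x -> u x <= C * phi x.
Proof.
move=> subsol.
have L1 := chart_bound chart.
have [U U0 uU] : exists2 U : R, 0 <= U & forall x, Omega x -> u x <= U.
  have clO : closure Omega !=set0 by exists x0; case: bx0.
  have [c] := compact_EVT_max clO (compact_closure_bounded bO) cu.
  move=> _ cmax; exists `|u c| => // x Ox; apply: le_trans (ler_norm _).
  by apply: cmax; rewrite inE; exact: subset_closure.
pose N : R := n%:R; have N0 : 0 <= N by exact: ler0n.
pose k := 2 * N + N * L + M * (1 + 2 * N + N * L) + 1.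
have NL0 : 0 <= N * L by apply: mulr_ge0 => //; lra.
have MNL0 : 0 <= M * (1 + 2 * N + N * L) by apply: mulr_ge0 => //; lra.
have k1 : 1 <= k by rewrite /k; lra.
have k0 : 0 < 1 / (4 * k) by rewrite divr_gt0//; lra.
have [r1 r10 Hr1] := near_sqdist (filterI (near_chart oO bx0 chart k0) subsol).
pose rho := Num.min 1 (r1 / 4).
have rho0 : 0 < rho by rewrite lt_min ltr01 divr_gt0.
have rho1 : rho <= 1 by rewrite ge_min lexx.
have rhor1 : rho ^+ 2 <= r1 ^+ 2 / 16.
  have -> : r1 ^+ 2 / 16 = (r1 / 4) ^+ 2 by field.
  rewrite ler_sqr ?nnegrE; [by rewrite ge_min lexx orbT|exact: ltW|].
  by rewrite divr_ge0// ltW.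
have rho20 : 0 < rho ^+ 2 by rewrite exprn_gt0.
pose A := 1 + U / rho ^+ 2.
have A1 : 1 <= A by rewrite lerDl divr_ge0// ltW.
have AU : U <= A * rho ^+ 2 by rewrite mulrDl mul1r divfK ?gt_eqF//; lra.
pose F t := A * (t - k * t ^+ 2); pose F1 t := A * (1 - 2 * k * t).
pose F2 (t : R) := - (2 * k * A).
have dF (s : R) : is_derive s 1 F (F1 s).
  have -> : F = fun t => A * t - (A * k) * t ^+ 2.
    by apply/funext => t; rewrite /F; ring.
  by apply: is_derive_eq; rewrite /F1 /GRing.scale/=; ring.
have dF1 (s : R) : is_derive s 1 F1 (F2 s).
  have -> : F1 = fun t => (- (2 * k * A)) * t + A.
    by apply/funext => t; rewrite /F1; ring.
  by apply: is_derive_eq; rewrite /F2 /GRing.scale/=; ring.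
have cF : continuous F.
  move=> s; apply/differentiable_continuous/derivable1_diffP.
  by have [] := dF s.
exists (2 * A); first by lra.
apply: filterS (near_chart oO bx0 chart rho0) => x [phix xr xr' Ox].
have phix0 : 0 < phi x by apply/(chart_domain chart xr').
have phixr : phi x < rho by rewrite -(gtr0_norm phix0).
have phix2 : phi x ^+ 2 < rho ^+ 2 by rewrite ltr_sqr ?nnegrE ?ltW.
pose y := x - phi x *: e.
have xy : sqdist x y = phi x ^+ 2.
  by rewrite sqdistC /y -scaleNr (chart_unit chart) sqrrN.
have r120 : 0 < r1 ^+ 2 by rewrite exprn_gt0.
have inball z : sqdist z y <= rho ^+ 2 -> sqdist z x0 < r1 ^+ 2.
  move=> zy; have := sqdist_triangle z y x0; have := sqdist_triangle y x x0.
  by rewrite (sqdistC y x) xy; lra.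
(* keeps [F] nonnegative and [F'] between 0 and [A] on the ball *)
have phi_small z : Omega z -> sqdist z y <= rho ^+ 2 ->
    0 < phi z /\ k * phi z < 1 / 4.
  move=> Oz /inball/Hr1[[phiz _ zr] _].
  have phiz0 : 0 < phi z by apply/(chart_domain chart zr).
  split=> //; move: phiz; rewrite gtr0_norm// ltr_pdivlMr; last lra.
  by lra.
have cw := continuous_barrier (y := y) (A := A) cF (chart_continuous chart).
apply: le_trans (comparison oO bO cu cw (y := y) (r := rho ^+ 2) _ _ _ Ox _) _.
- move=> z bz /inball/Hr1[[_ _ zr] _].
  rewrite u0// /barrier (chart_boundary_eq0 oO chart bz zr) /F.
  rewrite expr0n/= mulr0 subr0 mulr0 addr0.
  by apply: mulr_ge0; [lra|exact: sqdist_ge0].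
- move=> z Oz zy; have zy' : sqdist z y <= rho ^+ 2 by rewrite zy.
  have [phiz0 phizk] := phi_small z Oz zy'.
  apply: le_trans (uU z Oz) _; apply: le_trans AU _.
  rewrite /barrier zy lerDl /F mulr_ge0//; first lra.
  by rewrite expr2; nra.
- move=> z Oz zy zmax; have [phiz0 phizk] := phi_small z Oz (ltW zy).
  have [[_ _ zr] zsub] := Hr1 z (inball z (ltW zy)).
  have A0 : 0 <= A by lra.
  have H := le_trans (zsub Oz) (chart_touching_le oO chart C2u
    (fun s _ => dF s) (fun s _ => dF1 s) a01 M0 A0 (ltW rho0) Oz zr (ltW zy) zmax).
  have F1A : `|F1 (phi z)| <= A.
    rewrite /F1 normrM (ger0_norm (_ : 0 <= A)); last lra.
    have kphi0 : 0 <= k * phi z by apply: mulr_ge0; lra.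
    by rewrite ler_piMr// ler_norml; apply/andP; split; lra.
  have grad1 := chart_gradient chart z.
  have kA0 : 0 <= 2 * k * A by apply: mulr_ge0; lra.
  (* [k] was chosen so that [2 k A] exceeds the sum of all other terms, using
     [rho <= 1] and [1 <= A]. *)
  have h1 := ler_wpM2l kA0 grad1.
  have h2 := ler_wpM2l NL0 F1A.
  have h3 : N * (2 * A * rho + L * `|F1 (phi z)|) <= A * (2 * N + N * L).
    have : N * (2 * A) * rho <= N * (2 * A) * 1.
      by rewrite ler_wpM2l// mulr_ge0//; lra.
    by move: h2; lra.
  have h4 : M * (1 + N * (2 * A * rho + L * `|F1 (phi z)|)) <=
      A * (M * (1 + 2 * N + N * L)).
    rewrite mulrCA ler_wpM2l//; lra.
  have : A * k = A * (2 * N) + A * (N * L) + A * (M * (1 + 2 * N + N * L)) + A.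
    by rewrite /k; ring.
  move: H h1 h2 h4; rewrite /F2 -/N; lra.
- by rewrite xy ltW.
- rewrite /barrier xy /F.
  have phx1 : phi x <= 1 by lra.
  have A0 : 0 <= A by lra.
  have sq1 : phi x ^+ 2 <= phi x by rewrite expr2 ler_piMl// ltW.
  have ksq : 0 <= k * phi x ^+ 2 by apply: mulr_ge0; [lra|exact: sqr_ge0].
  have le2 : phi x ^+ 2 + (phi x - k * phi x ^+ 2) <= 2 * phi x by lra.
  by have := ler_wpM2l A0 le2; lra.
Qed.

End LinearBound.

(** * Non-existence under a strongly singular source *)

(** The absolute value extends the power continuously to the negative axis
    (where [powR] is 1), so that the barrier is continuous everywhere. *)
Lemma continuous_normr_powR (R : realType) (s : R) : 0 < s ->
  continuous (fun t : R => `|t| `^ s).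
Proof.
move=> s0 t; have [->|t0] := eqVneq t 0.
  rewrite /continuous_at normr0 powR0 ?gt_eqF//.
  apply/cvgrPdist_lt => d d0.
  have : \forall z \near (0 : R), `|z| < d `^ s^-1.
    by exists (d `^ s^-1) => [|z]; rewrite /= ?powR_gt0// sub0r normrN.
  apply: filterS => z zd; rewrite sub0r normrN ger0_norm ?powR_ge0//.
  have -> : d = (d `^ s^-1) `^ s by rewrite -powRrM mulVf ?gt_eqF// powRr1// ltW.
  by rewrite gt0_ltr_powR ?nnegrE ?powR_ge0.
apply: (@continuous_comp _ _ _ (fun z : R => `|z|) (fun z : R => z `^ s)).
  exact: norm_continuous.
apply/differentiable_continuous/derivable1_diffP.
have nt0 : 0 < `|t| by rewrite normr_gt0.
by have [] := is_derive1_powR s nt0.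
Qed.

Lemma is_derive_normr_powR (R : realType) (s t : R) : 0 < t ->
  is_derive t 1 (fun t : R => `|t| `^ s) (s * t `^ (s - 1)).
Proof.
move=> t0; have : \forall z \near t, z `^ s = `|z| `^ s.
  have : \forall z \near t, 0 < z by apply: (cvgr_gt _ (@cvg_id _ (nbhs t))).
  by apply: filterS => z z0; rewrite gtr0_norm.
move/near_eq_is_derive; apply; exact: is_derive1_powR.
Qed.

Section NoPositiveSolution.
Variables (R : realType) (n : nat) (Omega : set 'rV[R]_n) (x0 : 'rV[R]_n).
Variables (phi : 'rV[R]_n -> R) (e : 'rV[R]_n) (L r : R).
Hypotheses (oO : open Omega) (bO : bounded_set Omega) (bx0 : boundary Omega x0).
Hypothesis chart : boundary_chart Omega x0 phi e L r.
Variables (u : 'rV[R]_n -> R) (a M : R).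
Hypotheses (C2u : Ck 2 Omega u) (cu : {within closure Omega, continuous u}).
Hypothesis u0 : forall x, boundary Omega x -> u x = 0.
Hypothesis upos : forall x, Omega x -> 0 < u x.
Hypotheses (a01 : 0 < a < 1) (M0 : 0 <= M).
Variables (C c sigma : R).
Hypotheses (C0 : 0 < C) (c0 : 0 < c) (sigma01 : 0 < sigma < 1).
Hypothesis ubound : \forall x \near x0, Omega x -> u x <= C * phi x.
Hypothesis source : \forall x \near x0, Omega x ->
  c * phi x `^ (sigma - 2) <= laplacian u x + M * enorm (grad u x) `^ a.

(** The profile of the barrier: the linear part dominates the bound on [u], and
    the concave power pushes the barrier below 0 close to the boundary. *)
Let profile (K t : R) : R := C * t - K * `|t| `^ sigma.
Let profile1 (K t : R) : R := C - K * (sigma * t `^ (sigma - 1)).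
Let profile2 (K t : R) : R := K * (sigma * (1 - sigma) * t `^ (sigma - 2)).

Lemma is_derive_profile K (s : R) : 0 < s -> is_derive s 1 (profile K) (profile1 K s).
Proof.
move=> s0; have d := is_derive_normr_powR sigma s0.
have d1 := is_deriveZ K d; have d2 := is_deriveZ C (@is_derive_id _ _ s (1 : R)).
apply: is_derive_eq (is_deriveB d2 d1) _.
by rewrite /profile1 /GRing.scale/= mulr1.
Qed.

Lemma is_derive_profile1 K (s : R) :
  0 < s -> is_derive s 1 (profile1 K) (profile2 K s).
Proof.
move=> s0; have d := is_derive1_powR (sigma - 1) s0.
have d1 := is_deriveZ K (is_deriveZ sigma d).
apply: is_derive_eq (is_deriveB (is_derive_cst C s (1 : R)) d1) _.
rewrite /profile2 /GRing.scale/= sub0r.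
have -> : sigma - 1 - 1 = sigma - 2 by ring.
by ring.
Qed.

Lemma continuous_profile K : continuous (profile K).
Proof.
move=> s; apply: (@continuousB _ R^o _ (fun t : R => C * t)
  (fun t => K * `|t| `^ sigma)).
  apply: (@continuousM _ _ (fun=> C) id); [exact: cst_continuous|exact: cvg_id].
apply: (@continuousM _ _ (fun=> K)); first exact: cst_continuous.
by apply: continuous_normr_powR; case/andP: sigma01.
Qed.

(** The ball is fixed first, so small that the source dominates the terms [B1]
    coming from [C]; then [K] is taken so small that the remaining terms, all
    bounded by [K * B2 * phi^(sigma - 2)], fit into the other half of the source.
    With [A = K / rho^2] the quadratic part compensates [K phi^sigma] on the
    sphere. *)
Lemma no_positive_solution : False.
Proof.
have [s0 s1] := andP sigma01; have L1 := chart_bound chart.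
pose N : R := n%:R; have N0 : 0 <= N by exact: ler0n.
have L0 : 0 <= L by lra.
have NL0 : 0 <= N * L by exact: mulr_ge0.
pose B1 := N * L * C + M * (1 + N * L * C).
have B10 : 0 <= B1.
  have NLC : 0 <= N * L * C by rewrite mulr_ge0// ltW.
  by rewrite addr_ge0// mulr_ge0//; lra.
pose tau := Num.min 1 (c / (2 * (B1 + 1))).
have tau0 : 0 < tau by rewrite lt_min ltr01 divr_gt0//; lra.
have tau1 : tau <= 1 by rewrite ge_min lexx.
have tauB : tau * (2 * (B1 + 1)) <= c.
  by rewrite -ler_pdivlMr; [rewrite ge_min lexx orbT|lra].
have [r1 r10 Hr1] :=
  near_sqdist (filterI (near_chart oO bx0 chart tau0) (filterI ubound source)).
pose rho := r1 / 2; have rho0 : 0 < rho by rewrite divr_gt0.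
have rho20 : 0 < rho ^+ 2 by rewrite exprn_gt0.
have rhor1 : rho ^+ 2 < r1 ^+ 2 by rewrite ltr_sqr ?nnegrE ?ltW// /rho; lra.
have inball z : sqdist z x0 <= rho ^+ 2 -> sqdist z x0 < r1 ^+ 2.
  by move=> H; exact: le_lt_trans rhor1.
pose B2 := 2 * N / rho ^+ 2 + N * L ^+ 2 + N * L + M * N * (2 / rho + L).
have B20 : 0 <= B2.
  rewrite /B2 !addr_ge0// ?mulr_ge0 ?addr_ge0 ?divr_ge0 ?invr_ge0 ?sqr_ge0//; exact: ltW.
pose K := c / (4 * (B2 + 1)).
have K0 : 0 < K by rewrite divr_gt0//; lra.
have KB : K * B2 < c / 2.
  have : K * (4 * (B2 + 1)) = c by rewrite divfK// gt_eqF//; lra.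
  by move: K0 c0; lra.
pose A := K / rho ^+ 2.
have A0 : 0 < A by rewrite divr_gt0.
have AK : A * rho ^+ 2 = K by rewrite divfK// gt_eqF.
have uw x : Omega x -> sqdist x x0 <= rho ^+ 2 ->
    u x <= barrier A x0 (profile K) phi x.
  have cw := continuous_barrier (y := x0) (A := A) (continuous_profile (K := K))
    (chart_continuous chart).
  apply: (comparison oO bO cu cw) => {x} z.
  - move=> bz /inball/Hr1[[_ _ zr] _].
    rewrite u0// /barrier (chart_boundary_eq0 oO chart bz zr) /profile.
    rewrite normr0 powR0 ?gt_eqF// !mulr0 subr0 addr0.
    by rewrite mulr_ge0// ?sqdist_ge0// ltW.
  - move=> Oz zy; have /Hr1[[phiz _ zr] [/(_ Oz) uz _]] : sqdist z x0 < r1 ^+ 2.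
      by apply: inball; rewrite zy.
    have phiz0 : 0 < phi z by apply/(chart_domain chart zr).
    apply: le_trans uz _; rewrite /barrier zy AK /profile.
    have : `|phi z| `^ sigma <= 1 `^ sigma.
      by rewrite ge0_ler_powR ?nnegrE ?(ltW s0)//; exact: le_trans (ltW phiz) tau1.
    rewrite powR1 => le1.
    by have := ler_wpM2l (ltW K0) le1; lra.
  - move=> Oz zy zmax.
    have [[phiz _ zr] [_ /(_ Oz) src]] := Hr1 z (inball z (ltW zy)).
    have phiz0 : 0 < phi z by apply/(chart_domain chart zr).
    rewrite gtr0_norm// in phiz.
    have H := le_trans src (chart_touching_le oO chart C2u (@is_derive_profile K)
      (@is_derive_profile1 K) a01 M0 (ltW A0) (ltW rho0) Oz zr (ltW zy) zmax).
    set P := phi z `^ (sigma - 2) in H.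
    have P0 : 0 <= P by exact: powR_ge0.
    have phi1 : phi z <= 1 by lra.
    have P1 : phi z `^ (sigma - 1) <= P.
      by rewrite /P ger_powR ?phiz0//; lra.
    (* [phi z < tau <= 1] and [sigma - 2 <= - 1] *)
    have Ptau : 1 <= P * tau.
      have le1 : phi z `^ (-1) <= P by rewrite /P ger_powR ?phiz0//; lra.
      rewrite powR_inv1 in le1; last exact: ltW.
      have inv0 : 0 <= (phi z)^-1 by rewrite invr_ge0 ltW.
      have := ler_pM inv0 (ltW phiz0) le1 (ltW phiz).
      by rewrite mulVf// gt_eqF.
    have Pge1 : 1 <= P by apply: le_trans Ptau _; rewrite ler_piMr.
    have F1le : `|profile1 K (phi z)| <= C + K * P.
      rewrite /profile1; apply: le_trans (ler_normB _ _) _.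
      rewrite (gtr0_norm C0) lerD2l ger0_norm; last first.
        by apply: mulr_ge0 (ltW K0) (mulr_ge0 (ltW s0) _); exact: powR_ge0.
      rewrite ler_wpM2l ?(ltW K0)//.
      by apply: le_trans P1; rewrite ler_piMl ?powR_ge0// ltW.
    have F2le : profile2 K (phi z) <= K * P.
      rewrite /profile2 ler_wpM2l ?(ltW K0)// -/P ler_piMl//.
      by have : 0 <= sigma * sigma by [exact: mulr_ge0 (ltW s0) (ltW s0)]; lra.
    have F2ge0 : 0 <= profile2 K (phi z).
      by apply: mulr_ge0 (ltW K0) (mulr_ge0 (mulr_ge0 (ltW s0) _) (powR_ge0 _ _)); lra.
    have grad_le : \sum_(i < n) partial i phi z ^+ 2 <= N * L ^+ 2.
      rewrite /N -[X in X%:R * _](card_ord n) mulr_natl -sumr_const.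
      apply: ler_sum => i _; rewrite -(real_normK (num_real (partial i phi z))).
      by rewrite ler_sqr ?nnegrE//; exact: (chart_partial chart).
    have grad0 : 0 <= \sum_(i < n) partial i phi z ^+ 2.
      by apply: sumr_ge0 => i _; exact: sqr_ge0.
    have h1 : profile2 K (phi z) * (\sum_(i < n) partial i phi z ^+ 2) <=
        K * P * (N * L ^+ 2) by rewrite ler_pM.
    have h2 := ler_wpM2l NL0 F1le.
    have Arho : A * rho = K / rho.
      by rewrite /A expr2; field; rewrite gt_eqF.
    have KP : K <= K * P by rewrite ler_peMr// ltW.
    have h3 : 2 * N * A <= K * P * (2 * N / rho ^+ 2).
      have -> : 2 * N * A = K * (2 * N / rho ^+ 2) by rewrite /A; ring.
      rewrite ler_wpM2r// divr_ge0//; [exact: mulr_ge0|exact: ltW].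
    have h4 : N * (2 * A * rho + L * `|profile1 K (phi z)|) <=
        N * L * C + K * P * (N * (2 / rho + L)).
      have -> : N * (2 * A * rho + L * `|profile1 K (phi z)|) =
        K * (N * (2 / rho)) + N * L * `|profile1 K (phi z)|.
        by rewrite -(mulrA 2) Arho; ring.
      have : K * (N * (2 / rho)) <= K * P * (N * (2 / rho)).
        by rewrite ler_wpM2r// mulr_ge0// divr_ge0// ltW.
      by move: h2; lra.
    have h5 := ler_wpM2l M0 h4.
    have total : c * P <= B1 + K * B2 * P.
      by move: H h1 h2 h3 h5; rewrite -/N /B1 /B2; lra.
    have P00 : 0 < P by lra.
    have : K * B2 * P < c / 2 * P by rewrite ltr_pM2r.
    have : P * (tau * (2 * (B1 + 1))) <= P * c by rewrite ler_wpM2l.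
    have : (B1 + 1) <= P * tau * (B1 + 1) by rewrite ler_peMl//; lra.
    by lra.
have limt : (A + C) * t `^ (1 - sigma) @[t --> 0^'+] --> (0 : R).
  rewrite -[X in _ --> X](mulr0 (A + C)); apply: cvgM; first exact: cvg_cst.
  by apply: powR_cvg0; lra.
have small : \forall t \near (0 : R)^'+, (A + C) * t `^ (1 - sigma) < K.
  exact: (cvgr_lt _ limt).
have line : \forall t \near (0 : R)^'+, [/\ `|phi (x0 + t *: e)| < tau,
    sqdist (x0 + t *: e) x0 < rho ^+ 2 & sqdist (x0 + t *: e) x0 < r ^+ 2].
  apply: cvg_within; apply: (near_line e (P := fun x => [/\ `|phi x| < tau,
    sqdist x x0 < rho ^+ 2 & sqdist x x0 < r ^+ 2])).
  have n1 := near_chart oO bx0 chart tau0; have n2 := near_chart oO bx0 chart rho0.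
  by move: n1 n2; apply: filterS2 => x [? ? ?] [].
near (0 : R)^'+ => t.
have t0 : 0 < t by near: t; exact: nbhs_right_gt.
have t1 : t < 1 by near: t; exact: nbhs_right_lt.
have st : (A + C) * t `^ (1 - sigma) < K by near: t.
have [_ trho tr] : [/\ `|phi (x0 + t *: e)| < tau,
    sqdist (x0 + t *: e) x0 < rho ^+ 2 & sqdist (x0 + t *: e) x0 < r ^+ 2].
  by near: t.
have phit : phi (x0 + t *: e) = t.
  by rewrite (chart_vertical chart) (chart_center oO bx0 chart) add0r.
have Ot : Omega (x0 + t *: e).
  by apply/(chart_domain chart tr); rewrite phit.
have := uw _ Ot (ltW trho); have := upos Ot.
rewrite /barrier phit (chart_unit chart) /profile (gtr0_norm t0).
(* [t^sigma] beats the linear terms as [t] tends to 0 *)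
have tE : t = t `^ sigma * t `^ (1 - sigma).
  rewrite -powRD; last by rewrite (gt_eqF t0) implybT.
  by rewrite addrC subrK powRr1// ltW.
have ts0 : 0 < t `^ sigma by exact: powR_gt0.
have : t `^ sigma * ((A + C) * t `^ (1 - sigma)) < t `^ sigma * K.
  by rewrite ltr_pM2l.
rewrite mulrCA -tE.
have : A * t ^+ 2 <= A * t by rewrite ler_wpM2l ?(ltW A0)// expr2 ler_piMl// ltW.
by lra.
Unshelve. all: by end_near. Qed.

End NoPositiveSolution.

(** * The singular problem *)

(** Covers both signs of the exponent: for [b >= 0] the lower bound [t / k <= d]
    is used, for [b < 0] the upper bound [d <= t]. *)
Lemma powR_comparable (R : realType) (d t k b : R) : 0 < t -> 1 <= k ->
  d <= t -> t <= k * d -> k `^ (- `|b|) * t `^ b <= d `^ b.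
Proof.
move=> t0 k1 dt tkd.
have k0 : 0 < k by lra.
have d0 : 0 < d by rewrite -(pmulr_rgt0 _ k0); exact: lt_le_trans tkd.
have [b0|b0] := leP 0 b.
  rewrite ger0_norm// powRN ler_pdivrMl ?powR_gt0// -powRM ?(ltW k0) ?(ltW d0)//.
  by rewrite ge0_ler_powR ?nnegrE ?(ltW t0)// ltW// mulr_gt0.
have kb : k `^ (- `|b|) <= 1 by rewrite -(powRr0 k) ler_powR// oppr_le0.
apply: (@le_trans _ _ (t `^ b)); first by rewrite ler_piMl// powR_ge0.
rewrite -[b]opprK !(powRN _ (- b)) lef_pV2 ?posrE ?powR_gt0//.
by rewrite ge0_ler_powR ?nnegrE ?(ltW d0) ?(ltW t0)//; lra.
Qed.

Lemma powR_lower_bound (R : realType) (g : R -> R) (gamma l : R) : 0 < l ->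
  (s `^ gamma * g s) @[s --> 0^'+] --> l ->
  \forall s \near (0 : R)^'+, l / 2 * s `^ (- gamma) <= g s.
Proof.
move=> l0 gl; near=> s.
have s0 : 0 < s by near: s; exact: nbhs_right_gt.
rewrite powRN ler_pdivrMr ?powR_gt0// [leRHS]mulrC ltW//.
near: s; apply: (cvgr_gt _ gl); lra.
Unshelve. all: by end_near. Qed.

Lemma holder_near_bounded (R : realType) n (alpha : R) (A : set 'rV[R]_n)
    (q : 'rV[R]_n -> R) (x0 : 'rV[R]_n) : 0 < alpha -> holder alpha A q -> A x0 ->
  exists2 M : R, 0 <= M & \forall x \near x0, A x -> q x <= M.
Proof.
move=> al0 [H Hq] Ax0; exists (`|q x0| + `|H|); first exact: addr_ge0.
have : \forall x \near x0, sqdist x x0 < 1.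
  by apply: sqdist_near; rewrite sqdistxx.
apply: filterS => x /ltW x1 Ax.
have e1 : enorm (x - x0) `^ alpha <= 1.
  have <- : 1 `^ alpha = 1 :> R by rewrite powR1.
  rewrite ge0_ler_powR ?nnegrE ?sqrtr_ge0 ?(ltW al0)//.
  by rewrite enorm_sqdist -[leRHS]sqrtr1 ler_wsqrtr.
have h1 : H * enorm (x - x0) `^ alpha <= `|H|.
  apply: le_trans (ler_norm _) _; rewrite normrM (ger0_norm (powR_ge0 _ _)).
  by rewrite ler_piMr.
have := Hq x x0 Ax Ax0; have := ler_norm (q x - q x0); have := ler_norm (q x0).
lra.
Qed.

Lemma potential_lower_bound (R : realType) n (Omega : set 'rV[R]_n)
    (x0 : 'rV[R]_n) phi e L r (p : 'rV[R]_n -> R) (beta c1 : R) :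
  (0 < n)%N -> open Omega -> boundary Omega x0 ->
  boundary_chart Omega x0 phi e L r -> 0 < c1 ->
  (forall x, Omega x -> c1 * bdist Omega x `^ beta <= `|p x|) ->
  exists2 c : R, 0 < c & \forall x \near x0, Omega x -> c * phi x `^ beta <= `|p x|.
Proof.
move=> n0 oO bx0 chart c10 hp.
have L1 := chart_bound chart; have r0 := chart_radius chart.
have n1 : 1 <= n%:R :> R by rewrite ler1n.
have k1 : 1 <= n%:R * L.
  by apply: le_trans n1 _; rewrite ler_peMr.
have k0 : 0 < n%:R * L by lra.
exists (c1 * (n%:R * L) `^ (- `|beta|)); first by rewrite mulr_gt0// powR_gt0.
have r40 : 0 < r / 4 by rewrite divr_gt0.
apply: filterS (near_chart oO bx0 chart r40) => x [phix xr xr' Ox].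
have phix0 : 0 < phi x by apply/(chart_domain chart xr').
have rr : (r / 4) ^+ 2 = r ^+ 2 / 16 by field.
have r20 : 0 < r ^+ 2 by rewrite exprn_gt0.
rewrite rr in xr.
have phix2 : phi x ^+ 2 < r ^+ 2 / 16.
  by rewrite -rr -(real_normK (num_real (phi x))) ltr_sqr ?nnegrE// ltW.
apply: le_trans (hp x Ox); rewrite -mulrA ler_wpM2l ?(ltW c10)//.
apply: powR_comparable => //.
- by apply: (bdist_le_chart oO chart); [lra|lra|exact: ltW].
- exact: (chart_le_bdist oO bx0 chart).
Qed.

Theorem theorem4p1 (R : realType) (N : nat) (hN : (2 <= N)%N)
    (Omega : set 'rV[R]_N) (hOmega : smooth_bounded_domain Omega)
    (a : R) (ha : 0 < a < 1)
    (alpha : R) (halpha : 0 < alpha < 1)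
    (q : 'rV[R]_N -> R) (hq : holder alpha (closure Omega) q)
    (hq_pos : forall x, closure Omega x -> 0 < q x)
    (beta : R)
    (p : 'rV[R]_N -> R) (hp : Ck 1 Omega p)
    (hp_neg : forall x, Omega x -> p x < 0)
    (hp_bound : exists c1 c2 : R, [/\ 0 < c1, 0 < c2 &
      forall x, Omega x ->
        c1 * bdist Omega x `^ beta <= `|p x| <= c2 * bdist Omega x `^ beta])
    (g : R -> R) (hg : C1_pos g)
    (hg_pos : forall s, 0 < s -> 0 < g s)
    (hg_decr : forall s t, 0 < s -> s <= t -> g t <= g s)
    (hg_lim : g s @[s --> 0^'+] --> +oo)
    (hg_gamma : exists2 gamma : R, Num.max 1 (beta + 1) < gamma &
      exists2 l : R, 0 < l & (s `^ gamma * g s) @[s --> 0^'+] --> l) :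
  ~ exists u : 'rV[R]_N -> R, classical_solution Omega p q g a u.
Proof.
case: N hN Omega hOmega q hq hq_pos p hp hp_neg hp_bound => [//|n] _.
move=> Omega [oO _ O0 bO sm] q hq hq_pos p _ hp_neg [c1 [c2 [c10 _ hp]]].
move=> [u [C2u cu pde upos u0]].
have [x0 bx0] := exists_boundary oO bO O0.
have [phi [e [L [r chart]]]] := exists_boundary_chart sm bx0.
have al0 : 0 < alpha by case/andP: halpha.
have clx0 : closure Omega x0 by case: bx0.
have [M M0 qM] := holder_near_bounded al0 hq clx0.
have pg_le : \forall x \near x0, Omega x ->
    `|p x| * g (u x) <= laplacian u x + M * enorm (grad u x) `^ a.
  apply: filterS qM => x qM Ox; have qx := qM (subset_closure Ox).
  have := ler_wpM2r (powR_ge0 (enorm (grad u x)) a) qx.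
  by have := pde x Ox; rewrite (ltr0_norm (hp_neg x Ox)); lra.
have subsol : \forall x \near x0, Omega x ->
    0 <= laplacian u x + M * enorm (grad u x) `^ a.
  apply: filterS pg_le => x pg Ox; apply: le_trans (pg Ox).
  by rewrite mulr_ge0// ltW// hg_pos// upos.
have [C C0 uC] := linear_bound oO bO bx0 chart C2u cu u0 ha M0 subsol.
have hp' x : Omega x -> c1 * bdist Omega x `^ beta <= `|p x|.
  by move=> /hp/andP[].
have [c c0 pc] := potential_lower_bound (ltn0Sn n) oO bx0 chart c10 hp'.
have [gamma gamma_gt [l l0 gl]] := hg_gamma.
have [gamma1 gammab] : 1 < gamma /\ beta + 1 < gamma.
  by move: gamma_gt; rewrite gt_max => /andP[].
have [s0 /= s00 gs0] := powR_lower_bound l0 gl.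
(* For [phi <= 1] the source, of order [phi^(beta - gamma)], dominates
   [phi^(sigma - 2)]; the maximum with 1/2 keeps [sigma] positive. *)
pose sigma := Num.max (1 / 2) (beta - gamma + 2).
have sigma_beta : beta - gamma <= sigma - 2.
  have : beta - gamma + 2 <= sigma by rewrite le_max lexx orbT.
  by lra.
have sigma01 : 0 < sigma < 1.
  rewrite lt_max gt_max; apply/andP; split; first by apply/orP; left; lra.
  by apply/andP; split; lra.
have m0 : 0 < Num.min 1 (s0 / C) by rewrite lt_min ltr01 divr_gt0.
apply: (no_positive_solution oO bO bx0 chart C2u cu u0 upos ha M0 C0
  (c := c * (l / 2 * C `^ (- gamma))) _ sigma01 uC).
  by rewrite !mulr_gt0// ?powR_gt0// invr_gt0.
have near_phi := near_chart oO bx0 chart m0.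
apply: filterS (filterI near_phi (filterI pg_le (filterI uC pc))).
move=> x [[phix _ xr] [pg [ux px]]] Ox; apply: le_trans (pg Ox).
have phix0 : 0 < phi x by apply/(chart_domain chart xr).
move: phix; rewrite gtr0_norm// lt_min ltr_pdivlMr// => /andP[phi1 phis].
have Cphi0 : 0 < C * phi x by rewrite mulr_gt0.
have gu : l / 2 * (C * phi x) `^ (- gamma) <= g (u x).
  apply: le_trans (hg_decr _ _ (upos x Ox) (ux Ox)).
  by apply: gs0 => //; rewrite /ball_/= sub0r normrN gtr0_norm// mulrC.
apply: (@le_trans _ _ ((c * phi x `^ beta) * (l / 2 * (C * phi x) `^ (- gamma)))).
  rewrite powRM ?(ltW C0) ?(ltW phix0)//.
  have -> : c * phi x `^ beta * (l / 2 * (C `^ (- gamma) * phi x `^ (- gamma))) =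
    c * (l / 2 * C `^ (- gamma)) * (phi x `^ beta * phi x `^ (- gamma)) by ring.
  rewrite -powRD; last by rewrite (gt_eqF phix0) implybT.
  rewrite ler_wpM2l//; last by rewrite ger_powR ?phix0// ltW.
  by rewrite !mulr_ge0 ?powR_ge0 ?invr_ge0// ltW.
apply: ler_pM; [| |exact: px|exact: gu].
  by rewrite mulr_ge0 ?powR_ge0// ltW.
by rewrite mulr_ge0 ?powR_ge0// divr_ge0 ?ltW.
Qed.
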